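(* Let $k\geq 3$ be an integer. There exists $n_0=n_0(k)$ such that for every $n\geq n_0$, every graph $G$ of order $n$ with $\mu(G)\geq\mu(S_{n,k})$ and $G\neq S_{n,k}$ contains both $T_2$ and $T_3$ as subgraphs.
   Context: $\mu(G)$ denotes the spectral radius of the adjacency matrix of $G$. $S_{n,k}=K_k\vee\overline{K_{n-k}}$ (every vertex of a $K_k$ joined to every vertex of an independent set of size $n-k$). $T_2$ is the tree of order $2k+3$ consisting of a root $r$ adjacent to $k+2$ vertices, $k$ of which each have exactly one further leaf neighbour and the remaining $2$ of which are leaves. $T_3$ is the tree of order $2k+3$ consisting of a root $r$ adjacent to $k+1$ vertices $v_1,\ldots,v_{k+1}$, where $v_1$ has exactly two further leaf neighbours, each of $v_2,\ldots,v_k$ has exactly one further leaf neighbour, and $v_{k+1}$ is a leaf. *)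

(* Defs.v *)
From HB Require Import structures.
From mathcomp Require Import all_boot all_order all_algebra.
From mathcomp Require Import boolp classical_sets reals.
From mathcomp Require Import complex.

Set Implicit Arguments.
Unset Strict Implicit.
Unset Printing Implicit Defensive.

Import Order.TTheory GRing.Theory Num.Theory.

Local Open Scope ring_scope.

Record sgraph := SGraph {
  vertex :> finType;
  adj : rel vertex;
  adj_sym : symmetric adj;
  adj_irr : irreflexive adj
}.

Definition graph_iso (G H : sgraph) : Prop :=
  exists2 f : G -> H, bijective f & forall x y, adj (f x) (f y) = adj x y.

(* Subgraphs need not be induced: edges of [H] go to edges of [G], but
   non-edges may also go to edges. *)
Definition has_subgraph (G H : sgraph) : Prop :=
  exists2 f : H -> G, injective f & forall x y, adj x y -> adj (f x) (f y).

Definition adjacency_mx (R : realType) (G : sgraph) : 'M[R[i]]_#|G| :=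
  \matrix_(u, v) (adj (enum_val u) (enum_val v))%:R.

(* [`|z|] lives in [R[i]] (with zero imaginary part); [complex.Re] reads it
   back as a real number. The supremum is over a finite set, nonempty as soon
   as [0 < n]. *)
Definition spectral_radius (R : realType) (n : nat) (A : 'M[R[i]]_n) : R :=
  sup [set complex.Re `|z| | z in [set z : R[i] | eigenvalue A z]]%classic.

Definition mu (R : realType) (G : sgraph) : R :=
  spectral_radius (adjacency_mx R G).

Definition complete_rel (n : nat) : rel 'I_n := fun x y => x != y.

Fact complete_sym n : symmetric (@complete_rel n).
Proof. by move=> x y; rewrite /complete_rel eq_sym. Qed.

Fact complete_irr n : irreflexive (@complete_rel n).
Proof. by move=> x; rewrite /complete_rel eqxx. Qed.

Definition complete (n : nat) : sgraph :=
  SGraph (@complete_sym n) (@complete_irr n).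

Definition compl_rel (G : sgraph) : rel G :=
  fun x y => (x != y) && ~~ adj x y.

Fact compl_sym G : symmetric (@compl_rel G).
Proof. by move=> x y; rewrite /compl_rel eq_sym adj_sym. Qed.

Fact compl_irr G : irreflexive (@compl_rel G).
Proof. by move=> x; rewrite /compl_rel eqxx. Qed.

Definition compl (G : sgraph) : sgraph :=
  SGraph (@compl_sym G) (@compl_irr G).

Definition join_rel (G H : sgraph) : rel (G + H)%type :=
  fun x y => match x, y with
  | inl u, inl v => adj u v
  | inr u, inr v => adj u v
  | _, _ => true
  end.

Fact join_sym G H : symmetric (@join_rel G H).
Proof. by case=> [u|u] [v|v] //=; rewrite adj_sym. Qed.

Fact join_irr G H : irreflexive (@join_rel G H).
Proof. by case=> [u|u] /=; rewrite adj_irr. Qed.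

Definition join (G H : sgraph) : sgraph :=
  SGraph (@join_sym G H) (@join_irr G H).

(* The order is [n] only when [k <= n], since [n - k] is truncated. *)
Definition S_graph (n k : nat) : sgraph :=
  join (complete k) (compl (complete (n - k))).

(* Rooted tree of depth at most two, of order [1 + a + b]: [None] is the root,
   [Some (inl i)] for [i < a] are its neighbours, and [Some (inr j)] for
   [j < b] is a further leaf, attached to the neighbour [p j] of the root. *)
Section Tree2.
Variables (a b : nat) (p : 'I_b -> 'I_a).

Definition tree2_rel : rel (option ('I_a + 'I_b)) :=
  fun x y => match x, y with
  | None, Some (inl _) | Some (inl _), None => true
  | Some (inl i), Some (inr j) | Some (inr j), Some (inl i) => p j == i
  | _, _ => false
  end.

Fact tree2_sym : symmetric tree2_rel.
Proof. by move=> [[i|j]|] [[i'|j']|]. Qed.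

Fact tree2_irr : irreflexive tree2_rel.
Proof. by move=> [[i|j]|]. Qed.

Definition tree2 : sgraph := SGraph tree2_sym tree2_irr.

End Tree2.

(* The root neighbours with index [k] and [k + 1] are leaves. *)
Definition T2 (k : nat) : sgraph :=
  @tree2 k.+2 k (widen_ord (leq_addl 2 k)).

(* The leaves [0] and [k] are both attached to the root neighbour [0], and the
   root neighbour [k] is a leaf (for [0 < k]). *)
Definition T3 (k : nat) : sgraph :=
  @tree2 k.+1 k.+1 (fun j => if (j < k)%N then j else ord0).

(* Main.v *)
(* Let [W u] be the sum of the degrees of the neighbours of [u], i.e. the row
   sum at [u] of the square of the adjacency matrix [A].  If every row sum of
   [A^2 - (k - 1) A] were less than [k (n - k)], then testing the matrix against
   the vector [|v|], for an eigenvector [v] of eigenvalue [l], would give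
   [|l|^2 - (k - 1) |l| <= k (n - k) - 1] and hence [mu G < mu S_{n,k}]; only
   the triangle inequality [A |v| >= |l| |v|] is needed, not Perron-Frobenius.
   So some [u] has [W u >= (k - 1) d(u) + k (n - k)].

   For such [u], try to embed the trees with root [u]: one needs [k] disjoint
   paths of length two out of [u], one of them forked for [T_3], and spare
   neighbours of [u].  The many edges counted by [W u] supply them greedily,
   first from vertices of large degree, then from the remaining edges, unless
   [d(u) = k + 1], where [T_2] is found with a neighbour of [u] as root, or
   [G] has [k] vertices of degree [n - 1].  In the last case [G] contains
   [S_{n,k}], and any further edge completes both trees. *)
Require Import Defs.
From mathcomp Require Import all_boot all_order all_algebra.
From mathcomp Require Import reals zify lra.

Set Implicit Arguments.
Unset Strict Implicit.
Unset Printing Implicit Defensive.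

Import Order.TTheory GRing.Theory Num.Theory.
Local Open Scope nat_scope.

(** * Embedding the trees *)

(** [xs] receives the root neighbours and [ys] the further leaves. Injectivity is that of positions
    in a single duplicate-free list. *)
Lemma tree2_embed (G : sgraph) (a b : nat) (p : 'I_b -> 'I_a) (u : G)
    (xs ys : seq G) :
  size xs = a -> size ys = b -> uniq (u :: xs ++ ys) -> all (adj u) xs ->
  (forall j : 'I_b, adj (nth u xs (p j)) (nth u ys j)) ->
  has_subgraph G (tree2 p).
Proof.
move=> sx sy Un /allP ux xy.
pose idx (t : tree2 p) : nat := match t with
  | None => 0 | Some (inl i) => i.+1 | Some (inr j) => (a + j).+1 end.
have idx_lt t : idx t < size (u :: xs ++ ys).
  rewrite /= size_cat sx sy; case: t => [[i|j]|] //=.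
    by rewrite ltnS (leq_trans (ltn_ord i)) // leq_addr.
  by rewrite ltnS ltn_add2l.
have idx_inj : injective idx.
  move=> [[i|j]|] [[i'|j']|] //= [].
  - by move/val_inj->.
  - by move=> e; have := ltn_ord i; rewrite e ltnNge leq_addr.
  - by move=> e; have := ltn_ord i'; rewrite -e ltnNge leq_addr.
  - by move/addnI/val_inj->.
pose f t := nth u (u :: xs ++ ys) (idx t).
have fl (i : 'I_a) : f (Some (inl i)) = nth u xs i.
  by rewrite /f /= nth_cat sx ltn_ord.
have fr (j : 'I_b) : f (Some (inr j)) = nth u ys j.
  by rewrite /f /= nth_cat sx ltnNge leq_addr /= addKn.
have ufl (i : 'I_a) : adj u (nth u xs i).
  by apply: ux; rewrite mem_nth // sx.
exists f.
  by move=> s t /eqP; rewrite nth_uniq // => /eqP /idx_inj.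
move=> [[i|j]|] [[i'|j']|] //=; rewrite ?fl ?fr.
- by move/eqP <-.
- by rewrite adj_sym.
- by move/eqP <-; rewrite adj_sym.
- by [].
Qed.

(** * Fans of paths of length two *)

Definition verts (T : Type) (s : seq (T * T)) : seq T :=
  flatten [seq [:: q.1; q.2] | q <- s].

Lemma size_verts (T : Type) (s : seq (T * T)) : size (verts s) = 2 * size s.
Proof. by elim: s => //= q s /= ->; rewrite mulnS. Qed.

Lemma perm_verts (T : eqType) (s : seq (T * T)) :
  perm_eq (unzip1 s ++ unzip2 s) (verts s).
Proof.
elim: s => //= -[x y] s IH /=; rewrite perm_cons.
by rewrite perm_catC /= perm_cons perm_catC.
Qed.

Definition spoke (G : sgraph) (u : G) (q : G * G) : bool :=
  adj u q.1 && adj q.1 q.2.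

(* Disjoint paths of length two starting at [u], with endpoints avoiding [F]. *)
Definition fan (G : sgraph) (u : G) (F : seq G) (s : seq (G * G)) : bool :=
  all (spoke u) s && uniq (F ++ verts s).

Lemma spoke_nth (G : sgraph) (u : G) (s : seq (G * G)) (j : nat) :
  all (spoke u) s -> j < size s ->
  adj (nth u (unzip1 s) j) (nth u (unzip2 s) j).
Proof.
move=> /all_nthP sp js; rewrite !(nth_map (u, u)) //.
by have /andP[] := sp (u, u) _ js.
Qed.

Lemma spoke_unzip1 (G : sgraph) (u : G) (s : seq (G * G)) :
  all (spoke u) s -> all (adj u) (unzip1 s).
Proof. by elim: s => //= q s IH /andP[/andP[-> _] /IH]. Qed.

Lemma T2_of_fan (G : sgraph) (u p q : G) (s : seq (G * G)) :
  fan u [:: u; p; q] s -> adj u p -> adj u q -> has_subgraph G (T2 (size s)).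
Proof.
move=> /andP[sp Un] up uq.
apply: (@tree2_embed _ _ _ _ u (unzip1 s ++ [:: p; q]) (unzip2 s)).
- by rewrite size_cat size_map addn2.
- by rewrite size_map.
- have e : perm_eq (u :: (unzip1 s ++ [:: p; q]) ++ unzip2 s)
                   ([:: u; p; q] ++ verts s).
    rewrite perm_cons -catA perm_catCA /= !perm_cons.
    exact: perm_verts.
  by rewrite (perm_uniq e).
- by rewrite all_cat spoke_unzip1 //= up uq.
- move=> j /=; rewrite nth_cat size_map ltn_ord.
  exact: spoke_nth.
Qed.

Lemma T3_of_fan (G : sgraph) (u p z x y : G) (s : seq (G * G)) :
  fan u [:: u; p; z] ((x, y) :: s) -> adj u p -> adj x z ->
  has_subgraph G (T3 (size s).+1).
Proof.
move=> /andP[sp Un] up xz; set s' := (x, y) :: s in sp Un *.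
apply: (@tree2_embed _ _ _ _ u (unzip1 s' ++ [:: p]) (unzip2 s' ++ [:: z])).
- by rewrite size_cat size_map addn1.
- by rewrite size_cat size_map addn1.
- have e : perm_eq (u :: (unzip1 s' ++ [:: p]) ++ unzip2 s' ++ [:: z])
                   ([:: u; p; z] ++ verts s').
    rewrite perm_cons -catA perm_catCA perm_cons catA perm_catC /= perm_cons.
    exact: (perm_verts s').
  by rewrite (perm_uniq e).
- by rewrite all_cat spoke_unzip1 //= up.
- move=> j; case: ifP => js; rewrite !nth_cat !size_map.
    by rewrite !js; apply: spoke_nth.
  (* The last index is the second leaf at root neighbour [0]; its image is [z], placed at the end of
     the list. *)
  rewrite js /=.
  have -> : j = (size s).+1 :> nat by have := ltn_ord j; lia.
  by rewrite subnn.
Qed.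

Definition nbr (G : sgraph) (x : G) : {set G} := [set y | adj x y].

(* Neighbours of [x] along the edges that can extend an edge at [u] to a path
   of length two starting at [u], in either direction. *)
Definition nbr2 (G : sgraph) (u x : G) : {set G} :=
  [set y | [&& adj x y, y != u & adj u x || adj u y]].

Lemma pick_fresh (T : finType) (A : {set T}) (F : seq T) :
  size F < #|A| -> exists2 y, y \in A & y \notin F.
Proof.
move=> lt_FA; have /subsetPn[y yA yF] : ~~ (A \subset F).
  apply: contraL lt_FA => /subset_leq_card AF.
  by rewrite -leqNgt (leq_trans AF) // card_size.
by exists y.
Qed.

(** Greedy extension: each [x] in [Ds] gets a fresh partner [y], giving the path [u x y] or [u y x]
    according to which of the two is adjacent to [u]. Vertices of [Ds] still waiting stay forbidden,
    so no partner uses them up. *)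
Lemma fan_big (G : sgraph) (u : G) (F Ds : seq G) (s : seq (G * G)) :
  u \in F -> fan u (Ds ++ F) s ->
  (forall x, x \in Ds ->
     size F + 2 * (size Ds + size s) < #|nbr2 u x|) ->
  exists2 s', size s' = size s + size Ds & fan u F s'.
Proof.
move=> uF; elim: Ds s => [|x Ds IH] s; first by exists s; rewrite ?addn0.
move=> /andP[sp Un] big.
have [|y] := @pick_fresh _ (nbr2 u x) ((x :: Ds ++ F) ++ verts s).
  apply: leq_ltn_trans (big x (mem_head _ _)).
  by rewrite /= !size_cat size_verts /=; lia.
rewrite inE => /and3P[xy yu uxy] yF.
have Un2 : uniq ((Ds ++ F) ++ [:: x, y & verts s]).
  rewrite (@perm_uniq _ _ (y :: (x :: Ds ++ F) ++ verts s)) /=.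
    by rewrite yF.
  rewrite perm_catC /= perm_sym (perm_catCA [:: y] [:: x]) /= !perm_cons.
  by rewrite perm_catC.
have step q : spoke u q -> perm_eq [:: q.1; q.2] [:: x; y] ->
    exists2 s', size s' = (size s).+1 + size Ds & fan u F s'.
  move=> uq qxy; apply: (IH (q :: s)).
    rewrite /fan /= uq sp /=.
    rewrite (@perm_uniq _ _ ((Ds ++ F) ++ [:: x, y & verts s])) //.
    by rewrite perm_cat2l (perm_cat qxy).
  move=> x' x'D; apply: leq_ltn_trans (big x' _); first by rewrite /=; lia.
  by rewrite inE x'D orbT.
rewrite /= addnS -addSn.
case/orP: uxy => [ux|uy].
  by apply: (step (x, y)) => //; rewrite /spoke /= ux.
apply: (step (y, x)) => /=; first by rewrite /spoke /= uy adj_sym.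
by rewrite (perm_catC [:: y] [:: x]).
Qed.

Lemma T2_of_fan_big (G : sgraph) (k : nat) (u p q : G) (Ds : seq G)
    (s : seq (G * G)) :
  adj u p -> adj u q -> fan u (Ds ++ [:: u; p; q]) s ->
  size s + size Ds = k -> (forall x, x \in Ds -> 2 * k + 4 < #|nbr2 u x|) ->
  has_subgraph G (T2 k).
Proof.
move=> up uq fs sk big.
have [||s' ss' fs'] := fan_big _ fs; first by rewrite inE eqxx.
  by move=> x /big; apply: leq_ltn_trans => /=; lia.
by have <- : size s' = k by [lia]; apply: T2_of_fan fs' up uq.
Qed.

Lemma T3_of_fan_big (G : sgraph) (k : nat) (u v y z p : G) (Ds : seq G)
    (s : seq (G * G)) :
  adj u v -> adj v y -> adj v z -> adj u p ->
  fan u (Ds ++ [:: u; v; y; z; p]) s -> (size s + size Ds).+1 = k ->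
  (forall x, x \in Ds -> 2 * k + 4 < #|nbr2 u x|) ->
  has_subgraph G (T3 k).
Proof.
move=> uv vy vz up fs sk big.
have [||s' ss' /andP[sp Un]] := fan_big _ fs; first by rewrite inE eqxx.
  by move=> x /big; apply: leq_ltn_trans => /=; lia.
have <- : (size s').+1 = k by lia.
apply: (@T3_of_fan _ u p z v y s') => //.
apply/andP; split; first by rewrite /= sp /spoke /= uv vy.
rewrite (@perm_uniq _ _ [:: u, v, y, z, p & verts s']) //.
rewrite perm_sym perm_cons (perm_catCA [:: v; y] [:: z; p]) /=.
by rewrite (perm_catCA [:: z] [:: p]).
Qed.

Lemma fan_perm (G : sgraph) (u : G) (F F' : seq G) (s : seq (G * G)) :
  perm_eq F F' -> fan u F s -> fan u F' s.
Proof.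
move=> eF /andP[sp Un]; rewrite /fan sp /= (@perm_uniq _ _ (F ++ verts s)) //.
by rewrite perm_cat2r perm_sym.
Qed.

Lemma fan_pick (G : sgraph) (u : G) (A : {set G}) (F : seq G)
    (s : seq (G * G)) :
  fan u F s -> size F + 2 * size s < #|A| ->
  exists2 y, y \in A & fan u (rcons F y) s.
Proof.
move=> /andP[sp Un] lt_A; have [|y yA yF] := @pick_fresh _ A (F ++ verts s).
  by rewrite size_cat size_verts.
exists y => //; apply: (@fan_perm _ _ (y :: F)).
  by rewrite perm_sym perm_rcons.
by rewrite /fan sp /= yF.
Qed.

Lemma adj_of_nbr2 (G : sgraph) (u v y : G) : y \in nbr2 u v -> adj v y.
Proof. by rewrite inE => /and3P[]. Qed.

Definition good (G : sgraph) (k : nat) : Prop :=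
  has_subgraph G (T2 k) /\ has_subgraph G (T3 k).

(** One configuration serves both trees: [T_2] forgets [z] and uses [v y] as an ordinary path, [T_3]
    forgets [q] and keeps the fork at [v]. *)
Lemma good_of_cherry (G : sgraph) (k : nat) (u v y z p q : G) (Ds : seq G)
    (s : seq (G * G)) :
  adj u v -> adj v y -> adj v z -> adj u p -> adj u q ->
  fan u (Ds ++ [:: u; v; y; z; p; q]) s -> (size s + size Ds).+1 = k ->
  (forall x, x \in Ds -> 2 * k + 4 < #|nbr2 u x|) ->
  good G k.
Proof.
move=> uv vy vz up uq /andP[sp Un] sk big; split.
  apply: (T2_of_fan_big (Ds := Ds) (s := (v, y) :: s) up uq) => //.
  apply/andP; split; first by rewrite /= sp /spoke /= uv vy.
  have : uniq ([:: z] ++ (Ds ++ [:: u; p; q]) ++ [:: v, y & verts s]).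
    rewrite (@perm_uniq _ _ ((Ds ++ [:: u; v; y; z; p; q]) ++ verts s)) //.
    rewrite perm_catCA -!catA perm_cat2l /= !perm_cons.
    rewrite perm_sym (perm_catCA [:: v; y] [:: z; p; q]) /=.
    by rewrite (perm_catCA [:: z] [:: p; q]).
  by case/andP.
apply: (T3_of_fan_big uv vy vz up _ sk big); rewrite /fan sp /=.
have : uniq ([:: q] ++ (Ds ++ [:: u; v; y; z; p]) ++ verts s).
  rewrite (@perm_uniq _ _ ((Ds ++ [:: u; v; y; z; p; q]) ++ verts s)) //.
  by rewrite perm_catCA -!catA perm_cat2l.
by case/andP.
Qed.

Lemma good_of_cherry_large (G : sgraph) (k : nat) (u v y z : G) (Ds : seq G)
    (s : seq (G * G)) :
  adj u v -> adj v y -> adj v z ->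
  fan u (Ds ++ [:: u; v; y; z]) s -> (size s + size Ds).+1 = k ->
  (forall x, x \in Ds -> 2 * k + 4 < #|nbr2 u x|) -> 2 * k + 4 <= #|nbr u| ->
  good G k.
Proof.
move=> uv vy vz fs sk big du.
have [|p up fp] := fan_pick (A := nbr u) fs.
  by rewrite size_cat /=; lia.
(* Up to [2 * k + 3] vertices are forbidden here, whence the degree bound [2 * k + 4]. *)
have [|q uq fq] := fan_pick (A := nbr u) fp.
  by rewrite size_rcons size_cat /=; lia.
rewrite !inE in up uq; apply: good_of_cherry uv vy vz up uq _ sk big.
by move: fq; rewrite !rcons_cat.
Qed.

(** Since [nbr2 u v] is large, both leaves of the fork at [v] can be chosen last. *)
Lemma good_of_fan (G : sgraph) (k : nat) (u v : G) (Ds : seq G)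
    (s : seq (G * G)) :
  adj u v -> fan u (Ds ++ [:: u; v]) s -> (size s + size Ds).+1 = k ->
  (forall x, x \in v :: Ds -> 2 * k + 4 < #|nbr2 u x|) ->
  2 * k + 4 <= #|nbr u| ->
  good G k.
Proof.
move=> uv fs sk big du; have bv := big v (mem_head _ _).
have [|y /adj_of_nbr2 vy fy] := fan_pick (A := nbr2 u v) fs.
  by rewrite size_cat /=; lia.
have [|z /adj_of_nbr2 vz fz] := fan_pick (A := nbr2 u v) fy.
  by rewrite size_rcons size_cat /=; lia.
apply: (good_of_cherry_large (Ds := Ds) uv vy vz _ sk _ du).
  by move: fz; rewrite !rcons_cat.
by move=> x xD; apply: big; rewrite inE xD orbT.
Qed.

Lemma card_touching (T : finType) (E : {set T * T}) (c : nat) (S : seq T) :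
  (forall a, #|[set q in E | (a == q.1) || (a == q.2)]| <= c) ->
  #|[set q in E | (q.1 \in S) || (q.2 \in S)]| <= c * size S.
Proof.
move=> Ec; elim: S => [|a S IH] /=.
  rewrite muln0 leqn0 cards_eq0; apply/eqP/setP => q.
  by rewrite !inE andbF.
rewrite mulnS (leq_trans _ (leq_add (Ec a) IH)) //.
rewrite (leq_trans _ (leq_card_setU _ _)) // subset_leq_card //.
apply/subsetP => q; rewrite !inE => /andP[->] /=.
by rewrite ![a == _]eq_sym => /orP[] /orP[] ->; rewrite ?orbT.
Qed.

(** Greedy choice again: the forbidden vertices, at most [size F + 2 * m] of them, spoil at most [c]
    edges of [E] each. *)
Lemma fan_edges (G : sgraph) (u : G) (F : seq G) (E : {set G * G})
    (c m : nat) :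
  0 < c -> (forall q, q \in E -> spoke u q) ->
  (forall a, #|[set q in E | (a == q.1) || (a == q.2)]| <= c) ->
  c * (size F + 2 * m) <= #|E| -> uniq F ->
  exists2 s, size s = m & fan u F s.
Proof.
move=> c0 Es Ec + UF; elim: m => [|m IH] le_E.
  by exists [::]; rewrite // /fan /= cats0.
have [|s sm /andP[sp Un]] := IH; first by apply: leq_trans le_E; lia.
have := card_touching (F ++ verts s) Ec.
rewrite size_cat size_verts sm => cT.
have /subsetPn[q qE qF] :
    ~~ (E \subset [set q in E |
                    (q.1 \in F ++ verts s) || (q.2 \in F ++ verts s)]).
  by apply: contraL le_E => /subset_leq_card le_E; rewrite -ltnNge; nia.
have sq := Es q qE; rewrite inE qE /= negb_or in qF.
have /andP[q1 q2] := qF; exists (q :: s); first by rewrite /= sm.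
apply/andP; split; first by rewrite /= sq.
rewrite (@perm_uniq _ _ [:: q.1, q.2 & F ++ verts s]) /=.
  rewrite inE negb_or q1 q2 Un !andbT; apply: contraTN sq => /eqP e.
  by rewrite /spoke e adj_irr andbF.
by rewrite (perm_catCA F [:: q.1; q.2]).
Qed.

Lemma card_nbr (G : sgraph) (x : G) : #|nbr x| <= #|G|.-1.
Proof.
rewrite -(cardsC1 x) subset_leq_card //; apply/subsetP => y.
by rewrite !inE; apply: contraL => /eqP ->; rewrite adj_irr.
Qed.

Lemma nbr_full (G : sgraph) (x : G) :
  #|nbr x| = #|G|.-1 -> forall y, adj x y = (y != x).
Proof.
move=> ex y; have /eqP /setP /(_ y) : nbr x == [set~ x].
  rewrite eqEcard cardsC1 ex leqnn andbT; apply/subsetP => z.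
  by rewrite !inE; apply: contraL => /eqP ->; rewrite adj_irr.
by rewrite !inE.
Qed.

Lemma card_nbr_nbr2 (G : sgraph) (u v : G) :
  v \in nbr u -> #|nbr v| = #|nbr2 u v|.+1.
Proof.
rewrite inE => uv; have -> : nbr v = u |: nbr2 u v.
  apply/setP => y; rewrite !inE uv /= andbT.
  by case: eqVneq => [->|_]; rewrite /= ?andbT // adj_sym.
by rewrite cardsU1 !inE eqxx !andbF.
Qed.

Lemma sum_nbr_nbr2 (G : sgraph) (u : G) :
  \sum_(v in nbr u) #|nbr v| = \sum_(v in nbr u) #|nbr2 u v| + #|nbr u|.
Proof.
rewrite -sum1_card -big_split /=; apply: eq_bigr => v uv.
by rewrite (card_nbr_nbr2 uv) addn1.
Qed.

Lemma sum_le_card (T : finType) (A : {set T}) (f : T -> nat) (m : nat) :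
  (forall x, x \in A -> f x <= m) -> \sum_(x in A) f x <= #|A| * m.
Proof. by move=> le_f; rewrite -sum_nat_const leq_sum. Qed.

Lemma sum_nbr_le (G : sgraph) (A : {set G}) :
  \sum_(x in A) #|nbr x| + #|A| <= #|A| * #|G|.
Proof.
rewrite -[leqRHS]sum_nat_const -sum1_card -big_split leq_sum //= => x _.
have := card_nbr x; have : 0 < #|G| by apply/card_gt0P; exists x.
by rewrite addn1; case: #|G|.
Qed.

Lemma sum_tight (T : finType) (A : {set T}) (f : T -> nat) (m : nat) :
  (forall x, x \in A -> f x <= m) -> #|A| * m <= \sum_(x in A) f x ->
  forall x, x \in A -> f x = m.
Proof.
move=> le_f le_S x xA; apply/eqP; rewrite eqn_leq le_f //=.
rewrite leqNgt; apply: contraTN le_S => lt_f; rewrite -ltnNge.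
rewrite -sum_nat_const (bigD1 x) //= [in ltnRHS](bigD1 x) //=.
rewrite -addSn leq_add // leq_sum // => y /andP[yA _]; exact: le_f.
Qed.

Definition full_set (G : sgraph) (k : nat) (K : {set G}) : Prop :=
  #|K| = k /\ forall x, x \in K -> #|nbr x| = #|G|.-1.

(* [k - 1] vertices of large degree together with the root give [k - 1] spokes,
   and the extra edge outside them provides the last one. *)
Lemma good_of_full_set (G : sgraph) (k : nat) (K : {set G}) (a b : G) :
  3 <= k -> 4 * k + 8 <= #|G| -> full_set k K ->
  a \notin K -> b \notin K -> adj a b -> good G k.
Proof.
move=> k3 kG [cK fK] aK bK ab.
have [u uK] : exists u, u \in K by apply/set0Pn; rewrite -card_gt0; lia.
have cKu : #|K :\ u| = k.-1 by have := cardsD1 u K; rewrite uK; lia.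
have [v vKu] : exists v, v \in K :\ u by apply/set0Pn; rewrite -card_gt0; lia.
have cKv : #|K :\ u :\ v| = k.-2.
  by have := cardsD1 v (K :\ u); rewrite vKu; lia.
have adK x y : x \in K -> adj x y = (y != x) by move=> /fK /nbr_full.
have /andP[vu vK] : (v != u) && (v \in K) by move: vKu; rewrite !inE.
have neqK x c : x \in K -> c \notin K -> x != c.
  by move=> xK; apply: contraNneq => <-.
have ua : adj u a by rewrite adK //; apply: contraNneq aK => ->.
have ab_neq : a != b by apply: contraTneq ab => ->; rewrite adj_irr.
apply: (@good_of_fan _ _ u v (enum (K :\ u :\ v)) [:: (a, b)]).
- by rewrite adK.
- rewrite /fan /= /spoke /= ua ab /=.
  rewrite -catA cat_uniq enum_uniq /= !inE !mem_enum !inE !eqxx !andbF /=.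
  rewrite !negb_or !(eq_sym _ v) vu ab_neq (negPf aK) (negPf bK) !andbF /=.
  by rewrite !neqK.
- by rewrite -cardE cKv /=; lia.
- move=> x xD; have xK : x \in K :\ u.
    by move: xD; rewrite in_cons mem_enum => /orP[/eqP -> //|/setD1P[]].
  have /setD1P[xu xK'] := xK.
  have : x \in nbr u by rewrite inE adK.
  by move/card_nbr_nbr2; rewrite fK //; lia.
- by rewrite fK //; lia.
Qed.

(** * Roots with many walks of length two *)

(** The square is expanded so that linear arithmetic can treat [k * k] as an atom. *)
Lemma large_order (k n : nat) :
  20 * (k + 5) ^ 2 <= n -> k <= n /\ 20 * (k * k) + 200 * k + 500 <= n.
Proof.
move=> h; have : 20 * (k * k) + 200 * k + 500 <= n by lia.
by split; lia.
Qed.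

Lemma seq_of_card (T : finType) (A : {set T}) (m : nat) :
  m <= #|A| -> exists Ds : seq T, [/\ size Ds = m, uniq Ds & {subset Ds <= A}].
Proof.
move=> mA; exists (take m (enum A)); split.
- by rewrite size_takel // -cardE.
- exact/take_uniq/enum_uniq.
- by move=> x /mem_take; rewrite mem_enum.
Qed.

(* [walk_rich k u] says that the row sum of [A^2 - (k - 1) A] at [u], where [A]
   is the adjacency matrix, is at least [k (n - k)]; the subtractions are
   moved to the other side. *)
Definition walk_rich (G : sgraph) (k : nat) (u : G) : Prop :=
  k * #|nbr u| + k * #|G| <= \sum_(v in nbr u) #|nbr v| + #|nbr u| + k * k.

(** * Roots of small degree *)

(** With at most [k - 1] such neighbours, the sum of [#|nbr2 u v|] would be at most
    [(k - 1) n + (2 k + 3) (2 k + 4)], whereas [walk_rich] asks for at least [k n - k^2]. *)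
Lemma many_big_nbr (G : sgraph) (k : nat) (u : G) :
  3 <= k -> 20 * (k + 5) ^ 2 <= #|G| -> #|nbr u| <= 2 * k + 3 ->
  walk_rich k u -> k <= #|[set v in nbr u | 2 * k + 4 < #|nbr2 u v| ]|.
Proof.
move=> k3 nG du; rewrite /walk_rich sum_nbr_nbr2; set L := nbr u in du *.
set B := [set v in _ | _] => W; rewrite leqNgt; apply/negP => Bk.
have BL : L :&: B = B by apply/setP => x; rewrite !inE andbA andbb.
rewrite (big_setID B) /= BL in W.
have sB : \sum_(i in B) #|nbr2 u i| <= #|B| * #|G|.
  by apply: sum_le_card => x _; rewrite max_card.
have sC : \sum_(i in L :\: B) #|nbr2 u i| <= #|L :\: B| * (2 * k + 4).
  by apply: sum_le_card => x; rewrite !inE => /andP[/nandP[/negPf->//|]]; lia.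
have cC : #|L :\: B| <= 2 * k + 3 by have := cardsID B L; lia.
have sB' : #|B| * #|G| + #|G| <= k * #|G| by rewrite -mulSnr leq_mul2r Bk orbT.
have sC' : #|L :\: B| * (2 * k + 4) <= (2 * k + 3) * (2 * k + 4).
  by rewrite leq_mul2r; lia.
have e1 : 2 * #|L| <= k * #|L| by rewrite leq_mul2r; lia.
have [kn nq] := large_order nG.
move: nq (leq_trans sC sC') sB sB' e1 W; clear.
move: (\sum_(i in B) _) (\sum_(i in L :\: B) _) #|L| #|B| #|G|; clear.
lia.
Qed.

(** The paths run through [k] big neighbours of [u]. Beyond these, [T_3] needs one spare neighbour
    of the root and [T_2] needs two. *)
Lemma T3_of_walk_rich_small (G : sgraph) (k : nat) (u : G) :
  3 <= k -> 20 * (k + 5) ^ 2 <= #|G| -> k < #|nbr u| <= 2 * k + 3 ->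
  walk_rich k u ->
  has_subgraph G (T3 k) /\ (k.+2 <= #|nbr u| -> has_subgraph G (T2 k)).
Proof.
move=> k3 nG /andP[kd dk] W; have [kn nq] := large_order nG.
have := many_big_nbr k3 nG dk W.
case/seq_of_card => -[|v Ds] [/= szD UD sD]; first by lia.
have big x : x \in v :: Ds -> 2 * k + 4 < #|nbr2 u x|.
  by move/sD; rewrite inE => /andP[].
have [uv bv] : adj u v /\ 2 * k + 4 < #|nbr2 u v|.
  by have := sD v (mem_head _ _); rewrite !inE => /andP[].
have bigD x : x \in Ds -> 2 * k + 4 < #|nbr2 u x|.
  by move=> xD; apply: big; rewrite inE xD orbT.
have uD : u \notin Ds ++ [:: v].
  rewrite mem_cat inE orbC -in_cons; apply/negP => /sD.
  by rewrite !inE adj_irr.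
have f0 : fan u (Ds ++ [:: v]) [::].
  by rewrite /fan /= cats0 (@perm_uniq _ _ (v :: Ds)) // perm_catC.
have [|p up fp] := fan_pick (A := nbr u) f0.
  by rewrite size_cat /=; lia.
rewrite inE in up.
have pu : u != p by apply: contraTneq up => <-; rewrite adj_irr.
split.
  have f1 : fan u (Ds ++ [:: u; v; p]) [::].
    apply: (@fan_perm _ _ (u :: rcons (Ds ++ [:: v]) p)).
      by rewrite rcons_cat /= (perm_catCA [:: u]).
    move: fp; rewrite /fan /= !cats0 => ->.
    by rewrite mem_rcons inE negb_or pu uD.
  have [|y vy fy] := fan_pick (A := nbr2 u v) f1.
    by move: szD bv; clear; rewrite size_cat /=; lia.
  have [|z vz fz] := fan_pick (A := nbr2 u v) fy.
    by move: szD bv; clear; rewrite size_rcons size_cat /=; lia.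
  move/adj_of_nbr2: vy => vy; move/adj_of_nbr2: vz => vz.
  apply: (T3_of_fan_big uv vy vz up _ _ bigD (s := [::])); last by rewrite /=.
  apply: fan_perm fz; rewrite !rcons_cat /= perm_cat2l !perm_cons.
  by rewrite (perm_catCA [:: p] [:: y; z]).
move=> dk2; have [|q uq fq] := fan_pick (A := nbr u) fp.
  by move: szD dk2; clear; rewrite size_rcons size_cat /=; lia.
rewrite inE in uq.
have qu : u != q by apply: contraTneq uq => <-; rewrite adj_irr.
apply: (T2_of_fan_big (Ds := v :: Ds) (s := [::]) up uq _ _ big) => //.
apply: (@fan_perm _ _ (u :: rcons (rcons (Ds ++ [:: v]) p) q)).
  rewrite !rcons_cat /= (perm_catCA [:: u] Ds [:: v; p; q]) /=.
  rewrite perm_sym (perm_catCA [:: v] Ds) perm_cat2l.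
  by rewrite (perm_catCA [:: v] [:: u]).
move: fq; rewrite /fan /= !cats0 => ->.
by rewrite mem_rcons inE negb_or qu mem_rcons inE negb_or pu uD.
Qed.

(** The degree of [u] is too small for a root of [T_2], so the root moves to a neighbour [v]. One
    path is [v u w]; each other neighbour [x] of [u] shares many neighbours with [v]. This works
    because the neighbours of [u] have degree sum at least [k n - 1]. *)
Lemma T2_of_walk_rich_succ (G : sgraph) (k : nat) (u : G) :
  3 <= k -> 20 * (k + 5) ^ 2 <= #|G| -> #|nbr u| = k.+1 ->
  walk_rich k u -> has_subgraph G (T2 k).
Proof.
move=> k3 nG dk; rewrite /walk_rich dk => W.
have [kn nq] := large_order nG.
have [x0 x0L] : exists x, x \in nbr u by apply/set0Pn; rewrite -card_gt0 dk.
have [w wL wmin] := arg_minnP (fun v => #|nbr v|) x0L.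
have {}wL : w \in nbr u by [].
have cLw : #|nbr u :\ w| = k by have := cardsD1 w (nbr u); rewrite wL; lia.
have [v vLw] : exists v, v \in nbr u :\ w.
  by apply/set0Pn; rewrite -card_gt0; lia.
have cLwv : #|nbr u :\ w :\ v| = k.-1.
  by have := cardsD1 v (nbr u :\ w); rewrite vLw; lia.
rewrite (big_setD1 w) //= (big_setD1 v) //= in W.
have /setD1P[vw vL] := vLw.
have e1 : k.-1 * #|G| + #|G| = k * #|G|.
  by rewrite -mulSnr; congr (_ * _); move: k3; clear; lia.
have e2 : k.-2 * #|G| + 2 * #|G| = k * #|G|.
  by rewrite -mulnDl; congr (_ * _); move: k3; clear; lia.
have wv : #|nbr w| <= #|nbr v| := wmin v vL.
have nv : #|G| <= 2 * #|nbr v|.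
  have := sum_nbr_le (nbr u :\ w :\ v); rewrite cLwv; move: W wv e1 k3; clear.
  by move: #|G| (k.-1 * _) (\sum_(x in _) _); lia.
(* The other [k - 2] neighbours have degree at most [n - 1], so [w], [v], [x] have degree sum at
   least [2 n]. As [w] has least degree, [v] and [x] account for [4 n / 3] and share at least
   [n / 3] neighbours. *)
have big x : x \in enum (nbr u :\ w :\ v) -> 2 * k + 4 < #|nbr2 v x|.
  rewrite mem_enum => xL; have /setD1P[xv /setD1P[xw xL']] := xL.
  have cx : #|nbr u :\ w :\ v :\ x| = k.-2.
    by have := cardsD1 x (nbr u :\ w :\ v); rewrite xL; move: cLwv; clear; lia.
  have wx : #|nbr w| <= #|nbr x| := wmin x xL'.
  have := sum_nbr_le (nbr u :\ w :\ v :\ x); rewrite cx => Sx.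
  rewrite (big_setD1 x) //= in W.
  have sub : #|nbr v :&: nbr x| <= #|nbr2 v x|.
    apply/subset_leq_card/subsetP => y; rewrite !inE => /andP[vy xy].
    rewrite vy xy orbT /= andbT; apply: contraTneq vy => ->.
    by rewrite adj_irr.
  have := cardsUI (nbr v) (nbr x); have := max_card (nbr v :|: nbr x).
  move: nq sub Sx W wv wx e2; clear.
  move: #|G| (k.-2 * _) (\sum_(x in _) _). lia.
have /andP[uv uw] : adj u v && adj u w by move: vL wL; rewrite !inE => -> ->.
have f0 : fan v (enum (nbr u :\ w :\ v) ++ [:: v]) [:: (u, w)].
  rewrite /fan /= /spoke /= adj_sym uv uw /= -catA cat_uniq enum_uniq /=.
  rewrite !mem_enum !inE !eqxx adj_irr !andbF /= andbT negb_or vw.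
  have -> : v != u by apply: contraTneq uv => ->; rewrite adj_irr.
  by rewrite andbT; apply: contraTneq uw => ->; rewrite adj_irr.
have [|p vp fp] := fan_pick (A := nbr v) f0.
  by rewrite size_cat -cardE cLwv /=; move: nq nv; clear; lia.
have [|q vq fq] := fan_pick (A := nbr v) fp.
  by rewrite size_rcons size_cat -cardE cLwv /=; move: nq nv; clear; lia.
rewrite !inE in vp vq.
apply: (T2_of_fan_big vp vq _ _ big (s := [:: (u, w)])).
  by move: fq; rewrite !rcons_cat.
by rewrite -cardE cLwv /=; move: k3; clear; lia.
Qed.

(** * Roots of large degree *)

Definition big_vertices (G : sgraph) (k : nat) (u : G) : {set G} :=
  [set x | (x != u) && (2 * k + 4 < #|nbr2 u x|)].

Definition small_spokes (G : sgraph) (k : nat) (u : G) : {set G * G} :=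
  [set q | (q.1 \in nbr u :\: big_vertices k u)
        && (q.2 \in nbr2 u q.1 :\: big_vertices k u)].

Lemma card_small_spokes (G : sgraph) (k : nat) (u : G) :
  #|small_spokes k u| =
  \sum_(v in nbr u :\: big_vertices k u) #|nbr2 u v :\: big_vertices k u|.
Proof.
under eq_bigr do rewrite -sum1_card.
rewrite pair_big_dep /= -sum1_card; apply: eq_bigl => q.
by rewrite inE.
Qed.

Lemma small_spokes_spoke (G : sgraph) (k : nat) (u : G) (q : G * G) :
  q \in small_spokes k u -> spoke u q.
Proof.
rewrite inE => /andP[/setDP[uq _] /setDP[/adj_of_nbr2 qq _]].
by rewrite inE in uq; rewrite /spoke uq qq.
Qed.

Lemma small_spokes_avoid (G : sgraph) (k : nat) (u : G) (q : G * G) :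
  q \in small_spokes k u ->
  [/\ q.1 \notin big_vertices k u, q.2 \notin big_vertices k u,
      q.1 != u & q.2 != u].
Proof.
rewrite inE => /andP[/setDP[uq ->] /setDP[]]; rewrite !inE => /and3P[_ -> _] ->.
split=> //; apply: contraTneq uq => ->.
by rewrite inE adj_irr.
Qed.

(** A vertex [a] on a small spoke is not big, and the other end lies in [nbr2 u a]; the two
    orientations give [2 * (2 * k + 4)]. *)
Lemma small_spokes_touching (G : sgraph) (k : nat) (u a : G) :
  #|[set q in small_spokes k u | (a == q.1) || (a == q.2)]| <= 4 * k + 8.
Proof.
have [-> | [q0]] :=
  set_0Vmem [set q in small_spokes k u | (a == q.1) || (a == q.2)].
  by rewrite cards0.
rewrite inE => /andP[/small_spokes_avoid[D1 D2 u1 u2] aq].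
have small_a : #|nbr2 u a| <= 2 * k + 4.
  have sm x : x \notin big_vertices k u -> x != u -> #|nbr2 u x| <= 2 * k + 4.
    by rewrite inE [_ <= 2 * k + 4]leqNgt => + xu; rewrite xu.
  by case/orP: aq => /eqP ->; apply: sm.
have sub : [set q in small_spokes k u | (a == q.1) || (a == q.2)] \subset
    [set (a, y) | y in nbr2 u a] :|: [set (y, a) | y in nbr2 u a].
  apply/subsetP => -[x y]; rewrite inE => /andP[qS /=].
  have /andP[/= ux xy] := small_spokes_spoke qS.
  have [_ _ /= xu yu] := small_spokes_avoid qS.
  case/orP => /eqP ea; rewrite inE ea.
    by apply/orP; left; apply/imsetP; exists y; rewrite // inE xy yu ux.
  apply/orP; right; apply/imsetP; exists x => //.
  by rewrite inE adj_sym xy xu ux orbT.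
apply: leq_trans (subset_leq_card sub) _.
rewrite (leq_trans (leq_card_setU _ _)) //.
apply: leq_trans (leq_add (leq_imset_card _ _) (leq_imset_card _ _)) _.
by move: small_a; clear; lia.
Qed.

Lemma sum_small_nbr2 (G : sgraph) (k : nat) (u : G) :
  \sum_(v in nbr u :\: big_vertices k u) #|nbr2 u v| <=
  #|nbr u :\: big_vertices k u| * #|big_vertices k u| + #|small_spokes k u|.
Proof.
rewrite card_small_spokes -sum_nat_const -big_split leq_sum // => v _ /=.
by rewrite -(cardsID (big_vertices k u)) leq_add2r subset_leq_card ?subsetIr.
Qed.

Lemma fan_small_spokes (G : sgraph) (k m : nat) (u : G) (F : seq G) :
  uniq F -> (4 * k + 8) * (size F + 2 * m) <= #|small_spokes k u| ->
  exists2 s, size s = m & fan u F s.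
Proof.
move=> UF le_E; apply: fan_edges le_E UF; first by rewrite addn_gt0 orbT.
- exact: small_spokes_spoke.
- exact: small_spokes_touching.
Qed.

(** The fork is put at [v]. The other [k - 1] paths come from big vertices alone, from the [k - 2]
    big vertices other than [v] and one small spoke, or from all big vertices completed by small
    spokes. *)
Lemma good_of_big_nbr (G : sgraph) (k : nat) (u v : G) :
  3 <= k -> 2 * k + 4 <= #|nbr u| -> v \in nbr u -> v \in big_vertices k u ->
  [\/ k <= #|big_vertices k u|,
      #|big_vertices k u| = k.-1 /\ small_spokes k u != set0
    | (4 * k + 8) * (3 * k + 4) <= #|small_spokes k u|] ->
  good G k.
Proof.
move=> k3 du; rewrite inE => uv vB; set D := big_vertices k u in vB *.
have cDv : #|D| = #|D :\ v|.+1 by rewrite (cardsD1 v) vB.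
have big Ds : {subset Ds <= D :\ v} ->
    forall x, x \in v :: Ds -> 2 * k + 4 < #|nbr2 u x|.
  move=> sD x; rewrite in_cons => /orP[/eqP ->|xD].
    by move: vB; rewrite inE => /andP[].
  by have := sD x xD; rewrite !inE => /and3P[].
have UF Ds : uniq Ds -> {subset Ds <= D :\ v} -> uniq (Ds ++ [:: u; v]).
  move=> UD sD.
  have uD : u \notin Ds.
    by apply/negP => xD; have := sD _ xD; rewrite !inE eqxx andbF.
  have vD : v \notin Ds.
    by apply/negP => xD; have := sD _ xD; rewrite !inE eqxx.
  rewrite cat_uniq UD /= inE (negPf uD) (negPf vD) /= andbT.
  by apply: contraTneq uv => ->; rewrite adj_irr.
have enumD : {subset enum (D :\ v) <= D :\ v}.
  by move=> x; rewrite mem_enum.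
have UE := UF _ (enum_uniq (mem (D :\ v))) enumD.
have [kD|Dk] := leqP k #|D|.
  move=> _; have : k.-1 <= #|D :\ v| by move: kD; rewrite cDv; clear; lia.
  case/seq_of_card => Ds [sz UD sD].
  apply: (good_of_fan uv _ _ (big _ sD) du (s := [::])).
    by rewrite /fan /= cats0 UF.
  by rewrite sz; move: k3; clear; rewrite /=; lia.
have fan_good s : fan u (enum (D :\ v) ++ [:: u; v]) s -> size s + #|D| = k ->
    good G k.
  move=> fs ss; apply: (good_of_fan uv fs _ (big _ enumD) du).
  by rewrite -cardE -addnS -cDv.
case=> [|[Dk1 /set0Pn[q qE]]|le_E]; first by [].
  apply: (fan_good [:: q]); last first.
    by rewrite Dk1; move: k3; clear; rewrite /=; lia.
  have sq := small_spokes_spoke qE.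
  have [q1D q2D q1u q2u] := small_spokes_avoid qE.
  have q12 : q.1 != q.2.
    by apply: contraTneq sq => e; rewrite /spoke e adj_irr andbF.
  have qF x : x \notin D -> x != u -> x \notin enum (D :\ v) ++ [:: u; v].
    move=> xD xu; rewrite mem_cat mem_enum in_setD1 (negPf xD) andbF /=.
    by rewrite !inE negb_or xu /=; apply: contraNneq xD => ->.
  rewrite /fan /= sq /= cat_uniq UE /= (negPf (qF _ q1D q1u)).
  by rewrite (negPf (qF _ q2D q2u)) inE q12.
have [|s ss fs] := fan_small_spokes (k := k) (m := k - #|D|) (u := u) UE.
  apply: leq_trans le_E; rewrite leq_mul2l.
  have -> : size (enum (D :\ v) ++ [:: u; v]) = #|D|.+1.
    by rewrite size_cat -cardE cDv addn2.
  by apply/orP; right; move: Dk; clear; lia.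
by apply: fan_good fs _; rewrite ss subnK // ltnW.
Qed.

(** The fork at [v] may consume big vertices as leaves. If [nbr2 u v] consists of big vertices there
    are more than [k] of them; otherwise one leaf is chosen that is not big. Either way [k - 1] big
    vertices remain. *)
Lemma good_of_nbr2 (G : sgraph) (k : nat) (u v : G) :
  3 <= k -> 2 * k + 4 <= #|nbr u| -> v \in nbr u -> v \notin big_vertices k u ->
  k < #|nbr2 u v| ->
  k <= #|big_vertices k u| \/
    (4 * k + 8) * (3 * k + 4) <= #|small_spokes k u| ->
  good G k.
Proof.
move=> k3 du; rewrite inE => uv vB kv; set D := big_vertices k u in vB *.
have uv_neq : u != v by apply: contraTneq uv => ->; rewrite adj_irr.
have f0 : fan u [:: u; v] [::] by rewrite /fan /= inE uv_neq.
have pick (A : {set G}) y : y \in A -> y \in nbr2 u v ->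
    exists2 z, z \in nbr2 u v & uniq [:: u; v; y; z].
  move=> yA yv; have [|z zv] := @pick_fresh _ (nbr2 u v) [:: u; v; y].
    by move: k3 kv; clear; rewrite /=; lia.
  rewrite !inE !negb_or => /and3P[zu zv' zy]; exists z => //=.
  rewrite !inE !negb_or uv_neq (eq_sym u z) zu (eq_sym v z) zv' (eq_sym y z) zy.
  move: yv; rewrite inE => /and3P[vy yu _]; rewrite eq_sym yu /= !andbT.
  by apply: contraTneq vy => <-; rewrite adj_irr.
case=> [kD|le_E]; last first.
  have [y yv] : exists y, y \in nbr2 u v.
    by apply/set0Pn; rewrite -card_gt0; move: kv; clear; lia.
  have [z zv Un] := pick _ _ yv yv.
  have [|s ss fs] := fan_small_spokes (k := k) (m := k.-1) (u := u) Un.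
    apply: leq_trans le_E; rewrite leq_mul2l /=.
    by apply/orP; right; move: k3; clear; lia.
  apply: (good_of_cherry_large (Ds := [::]) (s := s) uv _ _ fs) => //.
  - exact: adj_of_nbr2 yv.
  - exact: adj_of_nbr2 zv.
  - by rewrite ss /= addn0 prednK //; move: k3; clear; lia.
have [y [z [yv zv Un cD]]] : exists y z, [/\ y \in nbr2 u v, z \in nbr2 u v,
    uniq [:: u; v; y; z] & k.-1 <= #|D :\ y :\ z| ].
  have cD2 y z : #|D| <= #|D :\ y :\ z| + (y \in D) + 1.
    rewrite (cardsD1 y D) (cardsD1 z (D :\ y)).
    by case: (z \in _); case: (y \in D); clear; lia.
  have [vD|/subsetPn[y yv yD]] := boolP (nbr2 u v \subset D).
    have [y yv] : exists y, y \in nbr2 u v.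
      by apply/set0Pn; rewrite -card_gt0; move: kv; clear; lia.
    have [z zv Un] := pick _ _ yv yv; exists y, z; split=> //.
    have := cD2 y z; have := subset_leq_card vD.
    by move: kv; case: (y \in D); clear; lia.
  have [z zv Un] := pick _ _ yv yv; exists y, z; split=> //.
  by have := cD2 y z; rewrite (negPf yD); move: kD; clear; lia.
case/seq_of_card: cD => Ds [sz UD sD].
apply: (good_of_cherry_large (Ds := Ds) (s := [::]) uv _ _ _ _ _ du).
- exact: adj_of_nbr2 yv.
- exact: adj_of_nbr2 zv.
- have uD : u \notin D by rewrite inE eqxx.
  rewrite /fan /= cats0 cat_uniq UD Un andbT -all_predC; apply/allP => x /=.
  rewrite !inE => xF; apply: contraL xF => xD; have := sD _ xD.
  rewrite !inE => /and4P[xz xy xu bx].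
  rewrite (negPf xz) (negPf xy) (negPf xu) /= orbF.
  by apply: contraNneq vB => <-; rewrite inE xu bx.
- by rewrite sz /= prednK //; move: k3; clear; lia.
- by move=> x /sD; rewrite !inE => /and4P[].
Qed.

(** Without small spokes, the upper bound on the walks from [u] only just reaches what [walk_rich]
    demands, so every estimate in it is an equality. *)
Lemma full_of_no_small_spokes (G : sgraph) (k : nat) (u : G) :
  3 <= k -> 20 * (k + 5) ^ 2 <= #|G| -> walk_rich k u ->
  #|big_vertices k u| = k.-1 -> small_spokes k u = set0 ->
  full_set k (u |: big_vertices k u).
Proof.
move=> k3 nG; have [kn nq] := large_order nG.
rewrite /walk_rich sum_nbr_nbr2; have := sum_small_nbr2 k u.
set L := nbr u; set D := big_vertices k u => + + cD S0.
rewrite S0 cards0 addn0 cD => sC; rewrite (big_setID D) /= => W.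
have le2 v : v \in L -> #|nbr2 u v| <= #|G| - 2.
  move=> vL; have := card_nbr_nbr2 vL; have := card_nbr v.
  by clear; lia.
have sD : \sum_(i in L :&: D) #|nbr2 u i| <= #|L :&: D| * (#|G| - 2).
  by apply: sum_le_card => v /setIP[/le2].
have cLD := cardsID D L.
have aD : #|L :&: D| <= k.-1 by rewrite -cD subset_leq_card // subsetIr.
have dn := card_nbr u.
have [m em] : exists m, #|G| = k + m + 2.
  by exists (#|G| - k - 2); move: nq; clear; lia.
have [j ej] : exists j, k = j.+1 by exists k.-1; move: k3; clear; lia.
(* With [a] the size of [L :&: D], the estimates combine to
   [(k - 1) (n - k - 1) <= a (n - k - 1)]. *)
have ak : #|L :&: D| = k.-1.
  apply/eqP; rewrite eqn_leq aD /= leqNgt; apply/negP => lt_a.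
  have [i ei] : exists i, j = #|L :&: D| + i.+1.
    by exists (j - #|L :&: D|.+1); move: lt_a; rewrite ej /=; clear; lia.
  move: sC W sD cLD dn nq; rewrite -/L em ej addnK /= ei.
  move: #|L| #|L :&: D| #|L :\: D|; clear => d a c.
  move: (\sum_(i in L :&: D) _) (\sum_(i in L :\: D) _); clear.
  move=> S0 S1 h1 h2 h3 hd h4; rewrite -{}hd in h2 h4 *.
  by have := leq0n (i * m); move: h1 h2 h3 h4; clear; lia.
have LD : L :&: D = D.
  by apply/eqP; rewrite eqEcard subsetIr ak cD leqnn.
have dn1 : #|L| = #|G|.-1.
  apply/eqP; rewrite eqn_leq dn /=.
  move: sC W sD cLD dn nq; rewrite -/L ak em ej addnK /=.
  move: #|L| #|L :\: D|; clear => d c.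
  move: (\sum_(i in L :&: D) _) (\sum_(i in L :\: D) _); clear; lia.
have tight : forall v, v \in D -> #|nbr2 u v| = #|G| - 2.
  apply: sum_tight => [v|]; first by rewrite -LD => /setIP[/le2].
  move: sC W cLD; rewrite LD dn1 cD em ej addnK /=.
  move: #|L :\: D| (\sum_(i in D) _) (\sum_(i in L :\: D) _); clear; lia.
split=> [|x]; first by rewrite cardsU1 cD inE eqxx ej.
rewrite in_setU1 => /predU1P[->//|xD].
have xL : x \in nbr u by move: xD; rewrite -{1}LD => /setIP[].
by rewrite (card_nbr_nbr2 xL) tight // em; clear; lia.
Qed.

(** Cases on whether [u] has a big neighbour to carry the fork, then on the numbers of big vertices
    and of small spokes. *)
Lemma good_or_full_large (G : sgraph) (k : nat) (u : G) :
  3 <= k -> 20 * (k + 5) ^ 2 <= #|G| -> 2 * k + 4 <= #|nbr u| ->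
  walk_rich k u -> good G k \/ exists K : {set G}, full_set k K.
Proof.
move=> k3 nG du Wu; have [kn nq] := large_order nG.
have W := Wu; rewrite /walk_rich sum_nbr_nbr2 in W.
rewrite (big_setID (big_vertices k u)) /= in W.
have := sum_small_nbr2 k u; set L := nbr u in du W *.
set D := big_vertices k u in W *; set S := small_spokes k u => sC.
have dn := card_nbr u.
have [LD0 | [v]] := set_0Vmem (L :&: D).
  have LD : L :\: D = L.
    by apply/eqP; rewrite eqEsubset subsetDl subsetD subxx -setI_eq0 LD0 eqxx.
  rewrite LD0 big_set0 add0n LD in W; rewrite LD in sC.
  (* Otherwise the sum would be at most [k d(u)], forcing [k n - k^2 <= 2 d(u) < 2 n], against
     [3 <= k]. *)
  have [v [vL kv]] : exists v, v \in L /\ k < #|nbr2 u v|.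
    have [/exists_inP[v vL kv]|/exists_inPn no] :=
      boolP [exists v in L, k < #|nbr2 u v|].
      by exists v.
    have : \sum_(i in L) #|nbr2 u i| <= #|L| * k.
      by apply: sum_le_card => x /no; rewrite -leqNgt.
    have : 3 * #|G| <= k * #|G| by rewrite leq_mul2r k3 orbT.
    move: W nq dn; rewrite -/L; clear; move: #|G| (\sum_(i in L) _) #|L|.
    by clear; lia.
  left; apply: (good_of_nbr2 k3 du vL _ kv).
    by apply/negP => vD; have := in_set0 v; rewrite -LD0 inE vL vD.
  have [kD|Dk] := leqP k #|D|; [by left | right].
  have : #|L| * #|D| + #|L| <= #|L| * k by rewrite -mulnSr leq_mul2l Dk orbT.
  have : 3 * #|G| <= k * #|G| by rewrite leq_mul2r k3 orbT.
  move: sC W nq dn; rewrite -/L -/D -/S; clear.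
  by move: #|G| (#|L| * #|D|) #|S| (\sum_(i in L) _) #|L|; clear; lia.
case/setIP => vL vD.
have [kD|Dk] := leqP k #|D|.
  by left; apply: (good_of_big_nbr k3 du vL vD); apply: Or31.
have [S_big|S_small] := leqP ((4 * k + 8) * (3 * k + 4)) #|S|.
  by left; apply: (good_of_big_nbr k3 du vL vD); apply: Or33.
have [Dk1|Dk1] := eqVneq #|D| k.-1.
  have [S0|S0] := eqVneq S set0.
    by right; exists (u |: D); apply: full_of_no_small_spokes.
  by left; apply: (good_of_big_nbr k3 du vL vD); apply: Or32.
(* In this last case the sum is at most [(k - 2) (n + d(u))] plus the few small spokes, so [2 n]
   would be bounded by a quadratic in [k]. *)
have lt_D : #|D| + 2 <= k by move: Dk Dk1; clear; lia.
have sD : \sum_(i in L :&: D) #|nbr2 u i| <= #|L :&: D| * #|G|.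
  by apply: sum_le_card => x _; exact: max_card.
have sD' : #|L :&: D| * #|G| <= #|D| * #|G|.
  by rewrite leq_mul2r subset_leq_card ?orbT // subsetIr.
have sD2 : #|D| * #|G| + 2 * #|G| <= k * #|G|.
  by rewrite -mulnDl leq_mul2r lt_D orbT.
have sC' : #|L :\: D| * #|D| <= #|L| * #|D|.
  by rewrite leq_mul2r subset_leq_card ?orbT // subsetDl.
have sC2 : #|L| * #|D| + 2 * #|L| <= k * #|L|.
  by rewrite (mulnC 2) -mulnDr mulnC leq_mul2r lt_D orbT.
exfalso; move: (leq_trans sD sD') sD2 W nq S_small sC2; clear -sC sC'.
have : \sum_(i in L :\: D) #|nbr2 u i| <= #|L| * #|D| + #|S|.
  by apply: leq_trans sC _; rewrite leq_add2r.
clear; move: #|G| #|S| #|L| #|D| (\sum_(i in L :&: D) _).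
by move: (\sum_(i in L :\: D) _); clear; lia.
Qed.

(** Degree below [k] contradicts [walk_rich]; degree exactly [k] forces the neighbours to have
    degree sum [k (n - 1)], hence to be full. *)
Lemma good_or_full (G : sgraph) (k : nat) (u : G) :
  3 <= k -> 20 * (k + 5) ^ 2 <= #|G| -> walk_rich k u ->
  good G k \/ exists K : {set G}, full_set k K.
Proof.
move=> k3 nG W; have [kn nq] := large_order nG.
have [big_d|small_d] := leqP (2 * k + 4) #|nbr u|.
  exact: good_or_full_large W.
have [lt_kd|le_dk] := ltnP k #|nbr u|.
  have k_d : k < #|nbr u| <= 2 * k + 3.
    by rewrite lt_kd; move: small_d; clear; lia.
  left; have [t3 t2] := T3_of_walk_rich_small k3 nG k_d W; split=> //.
  have [/t2 //|dk] := leqP k.+2 #|nbr u|.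
  apply: T2_of_walk_rich_succ W => //.
  by apply/eqP; rewrite eqn_leq lt_kd andbT.
have := sum_nbr_le (nbr u); move: W; rewrite /walk_rich => W sW.
have [ltdk|gedk] := ltnP #|nbr u| k.
  have dG : #|nbr u| * #|G| + #|G| <= k * #|G|.
    by rewrite -mulSnr leq_mul2r ltdk orbT.
  exfalso; move: dG W sW nq; clear.
  have := leq0n (k * #|nbr u|); move: #|nbr u| #|G| (\sum_(i in _) _).
  by clear; lia.
have dk : #|nbr u| = k by apply/eqP; rewrite eqn_leq le_dk.
right; exists (nbr u); split=> //; apply: sum_tight => [x _|].
  exact: card_nbr.
rewrite dk in W sW *; have [m em] : exists m, #|G| = m.+1.
  by exists #|G|.-1; move: nq; clear; lia.
by move: W; rewrite em /=; move: (\sum_(x in _) _); clear; lia.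
Qed.

(** * Recognizing the extremal graph *)

Lemma iso_of_full_set (G : sgraph) (k : nat) (K : {set G}) :
  full_set k K -> (forall a b, a \notin K -> b \notin K -> ~~ adj a b) ->
  graph_iso G (S_graph #|G| k).
Proof.
move=> [cK fK] noedge.
have cKC : #|~: K| = #|G| - k by have := cardsC K; rewrite cK; clear; lia.
pose g (t : S_graph #|G| k) : G := match t with
  | inl i => enum_val (cast_ord (esym cK) i)
  | inr j => enum_val (cast_ord (esym cKC) j) end.
have gl i : g (inl i) \in K by apply: enum_valP.
have gr j : g (inr j) \notin K.
  by have := enum_valP (cast_ord (esym cKC) j); rewrite inE.
have g_inj : injective g.
  move=> [i|i] [j|j] e.
  - by have /cast_ord_inj -> := enum_val_inj e.
  - by have := gr j; rewrite -e gl.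
  - by have := gr i; rewrite e gl.
  - by have /cast_ord_inj -> := enum_val_inj e.
have g_bij : bijective g.
  apply: inj_card_bij => //; rewrite card_sum !card_ord.
  by have := max_card K; rewrite cK; clear; lia.
have g_adj s t : adj (g s) (g t) = adj s t.
  have full x y : x \in K -> adj x y = (y != x) by move=> /fK /nbr_full.
  case: s t => [i|i] [j|j].
  - by rewrite full // (inj_eq g_inj) eq_sym.
  - by rewrite full //; apply: contraNneq (gr j) => ->.
  - by rewrite adj_sym full //; apply: contraNneq (gr i) => ->.
  - by rewrite (negPf (noedge _ _ (gr i) (gr j))) /= /compl_rel /= andbN.
have [f fK' gK] := g_bij; exists f; first by exists g.
by move=> x y; rewrite -g_adj !gK.
Qed.

(** * Spectral radius *)

From mathcomp Require Import boolp classical_sets complex.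

Local Open Scope ring_scope.

Lemma sum_nbr_exchange (R : nmodType) (G : sgraph) (F : G -> G -> R) :
  \sum_x \sum_(z in nbr x) F x z = \sum_z \sum_(x in nbr z) F x z.
Proof.
rewrite (exchange_big_dep xpredT) //=; apply: eq_bigr => z _.
by apply: eq_bigl => x; rewrite !inE adj_sym.
Qed.

(* With [P] the degree-weighted sum of [y], summing [A y >= r y] gives
   [P >= r Y], and weighting by degrees gives [Q >= r P]. *)
Lemma walk_rich_bound (R : realFieldType) (G : sgraph) (k : nat) (r : R)
    (y : G -> R) :
  (forall x, 0 <= y x) -> 0 < \sum_x y x ->
  (forall x, r * y x <= \sum_(z in nbr x) y z) ->
  (forall x : G, ~ walk_rich k x) -> 0 <= r -> (0 < k)%N ->
  k%:R * k%:R + 1 <= k%:R * #|G|%:R :> R ->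
  r * r + (k%:R * k%:R + 1) <= (k%:R - 1) * r + k%:R * #|G|%:R.
Proof.
move=> y0 Y0 yA poor r0 k0 kn; set Y := \sum_x y x in Y0.
pose P := \sum_x #|nbr x|%:R * y x.
pose Q := \sum_x (\sum_(z in nbr x) #|nbr z|)%:R * y x.
have rY : r * Y <= P.
  rewrite mulr_sumr; apply: le_trans (ler_sum _ (fun x _ => yA x)) _.
  rewrite sum_nbr_exchange /P; apply: ler_sum => x _.
  by rewrite sumr_const mulr_natl.
have rP : r * P <= Q.
  rewrite /Q; under eq_bigr do rewrite natr_sum mulr_suml.
  rewrite sum_nbr_exchange mulr_sumr; apply: ler_sum => x _.
  by rewrite -mulr_sumr mulrCA ler_wpM2l.
(* The [+ 1] comes from integrality: the failure of [walk_rich] is a strict inequality between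
   natural numbers. *)
have QP : Q + P + (k%:R * k%:R + 1) * Y <= k%:R * P + k%:R * #|G|%:R * Y.
  rewrite /Q /P /Y !mulr_sumr -!big_split /=; apply: ler_sum => x _.
  rewrite !mulrA -!mulrDl ler_wpM2r // -!natrM -!natrD.
  rewrite natr1 -natrD ler_nat.
  have /negP := poor x; rewrite -ltnNge.
  by move: #|G| #|nbr x| (\sum_(z in _) _)%N; clear; lia.
rewrite -(ler_pM2r Y0).
(* For [r < k - 1] the claim splits into [r * r <= (k - 1) * r] and the assumed bound on
   [k * k + 1]. *)
case: (leP (k%:R - 1) r) => kr; last first.
  apply: ler_wpM2r; first exact: ltW.
  by apply: lerD => //; apply: ler_wpM2r => //; exact: ltW.
have : 0 <= (r - (k%:R - 1)) * (P - r * Y).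
  by rewrite mulr_ge0 // subr_ge0.
by nra.
Qed.

Lemma eigenvalue_nbr (R : realType) (G : sgraph) (l : R[i]) :
  eigenvalue (adjacency_mx R G) l ->
  exists y : G -> R, [/\ forall x, 0 <= y x, 0 < \sum_x y x
    & forall x, complex.Re `|l| * y x <= \sum_(z in nbr x) y z].
Proof.
case/eigenvalueP => v vA v0; pose nrm (z : R[i]) : R := complex.Re `|z|.
have nE z : `|z| = (nrm z)%:C%C by [].
have n0 z : 0 <= nrm z by rewrite -lecR -nE normr_ge0.
exists (fun x => nrm (v 0 (enum_rank x))); split=> // [|x].
  rewrite lt_neqAle sumr_ge0 // andbT eq_sym; apply: contra v0.
  rewrite psumr_eq0 // => /allP v0; apply/eqP/rowP => j; rewrite mxE.
  have := v0 (enum_val j) (mem_index_enum _); rewrite /= enum_valK => /eqP e.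
  by apply/normr0_eq0; rewrite nE e.
have /rowP /(_ (enum_rank x)) := vA; rewrite !mxE => e.
rewrite -lecR rmorphM rmorph_sum /= -!nE -normrM -e.
apply: le_trans (ler_norm_sum _ _ _) _.
rewrite (reindex (@enum_rank G)) /=; last exact/onW_bij/enum_rank_bij.
rewrite [leRHS]big_mkcond /=; apply: ler_sum => z _.
rewrite mxE !enum_rankK normrM inE adj_sym.
by case: adj; rewrite ?normr1 ?mulr1 // normr0 mulr0.
Qed.

(** This crude bound makes the set of moduli bounded above, so that its supremum is meaningful. *)
Lemma eigenvalue_le_order (R : realType) (G : sgraph) (l : R[i]) :
  eigenvalue (adjacency_mx R G) l -> complex.Re `|l| <= #|G|%:R.
Proof.
case/eigenvalue_nbr => y [y0 Y0 yA].
rewrite -(ler_pM2r Y0) mulr_sumr.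
apply: le_trans (ler_sum _ (fun x _ => yA x)) _.
rewrite sum_nbr_exchange mulr_sumr; apply: ler_sum => x _.
rewrite sumr_const -[leLHS]mulr_natl ler_wpM2r // ler_nat.
exact: max_card.
Qed.

Lemma mu_ge_eigenvalue (R : realType) (G : sgraph) (l : R[i]) :
  eigenvalue (adjacency_mx R G) l -> complex.Re `|l| <= mu R G.
Proof.
move=> el; apply: ub_le_sup; last by exists l.
by exists #|G|%:R => _ [z ez <-]; apply: eigenvalue_le_order.
Qed.

Lemma mu_le (R : realType) (G : sgraph) (b : R) : 0 <= b ->
  (forall l, eigenvalue (adjacency_mx R G) l -> complex.Re `|l| <= b) ->
  mu R G <= b.
Proof.
move=> b0 lb; rewrite /mu /spectral_radius; set E := (X in sup X).
(* The supremum of the empty set is [0], whence the assumption [0 <= b]. *)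
have [->|E0] := eqVneq E set0; first by rewrite sup0.
apply: ge_sup; first exact/set0P.
by move=> _ [z ez <-]; apply: lb.
Qed.

(* The larger root of [x^2 - (k - 1) x = k (n - k)]; the eigenvector is [x] on
   the clique and [k] on the independent set. *)
Lemma mu_S_graph_ge (R : realType) (n k : nat) (x : R) :
  (0 < k <= n)%N -> 0 < x ->
  x * x = (k%:R - 1) * x + k%:R * (n%:R - k%:R) ->
  x <= mu R (S_graph n k).
Proof.
move=> /andP[k0 kn] x0 xE.
suff el : eigenvalue (adjacency_mx R (S_graph n k)) x%:C%C.
  apply: le_trans (mu_ge_eigenvalue el).
  by rewrite normc_def /= expr0n addr0 sqrtr_sqr ler_norm.
apply/eigenvalueP.
pose f (t : S_graph n k) : R := if t is inl _ then x else k%:R.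
exists (\row_j (f (enum_val j))%:C%C).
  apply/rowP => j; rewrite !mxE -rmorphM.
  rewrite (reindex (@enum_rank (S_graph n k))) /=; last first.
    exact/onW_bij/enum_rank_bij.
  under eq_bigr => z _ do rewrite !mxE !enum_rankK.
  set w := enum_val j; rewrite big_sumType /=.
  case: w => [v|v] /=.
    rewrite -!mulr_sumr sumr_const card_ord (bigD1 v) //=.
    rewrite /complete_rel eqxx add0r (eq_bigr (fun=> 1)) => [|i ->] //.
    rewrite sumr_const cardC1 card_ord xE.
    rewrite !rmorphD !rmorphM !rmorphB /= !rmorph_nat rmorph1.
    by rewrite natrB // -subn1 natrB // mulrC.
  rewrite [X in _ + X]big1 => [|i _]; last by rewrite /compl_rel /= andbN mulr0.
  rewrite addr0 (eq_bigr (fun=> x%:C%C)) => [|i _]; last by rewrite mulr1.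
  by rewrite sumr_const card_ord rmorphM /= rmorph_nat mulr_natr.
apply/eqP => /rowP /(_ (enum_rank (inl (Ordinal k0) : S_graph n k))).
rewrite !mxE enum_rankK /= => /eqP.
by rewrite (fmorph_eq0 (real_complex R)) gt_eqF.
Qed.

Lemma walk_rich_exists (R : realType) (G : sgraph) (k : nat) :
  (0 < k)%N -> (2 * k + 2 <= #|G|)%N -> mu R (S_graph #|G| k) <= mu R G ->
  exists u : G, walk_rich k u.
Proof.
move=> k0 nk mu_le_mu; apply: contrapT => none.
pose c : R := k%:R - 1; pose N : R := k%:R * #|G|%:R - k%:R * k%:R.
have c0 : 0 <= c by rewrite subr_ge0 ler1n.
have N2 : 2 <= N.
  rewrite /N -mulrBr -natrB; last by move: nk; clear; lia.
  rewrite -natrM (ler_nat _ 2) (@leq_mul 1 2) //.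
  by move: nk; clear; lia.
(* The larger root of [t^2 - c t = d]. Poor walks everywhere give [mu R G <= root (N - 1)], while
   [S_graph] reaches [root N]. *)
pose root (d : R) : R := (c + Num.sqrt (c * c + 4 * d)) / 2.
have root_ge0 d : 0 <= root d by rewrite divr_ge0 // addr_ge0 // sqrtr_ge0.
have sq d : 0 <= d ->
    Num.sqrt (c * c + 4 * d) * Num.sqrt (c * c + 4 * d) = c * c + 4 * d.
  by move=> d0; rewrite -expr2 sqr_sqrtr // addr_ge0 ?mulr_ge0.
have lt_root : root (N - 1) < root N.
  by rewrite /root ltr_pM2r ?invr_gt0 ?ltr0n // ltrD2l ltr_sqrt; nra.
have S_ge : root N <= mu R (S_graph #|G| k).
  apply: mu_S_graph_ge; first by rewrite k0; move: nk; clear; lia.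
    exact: le_lt_trans lt_root.
  rewrite mulrBr -/c -/N; have := sq N; rewrite /root.
  by move: (Num.sqrt _) => s /(_ ltac:(lra)); nra.
have G_le : mu R G <= root (N - 1).
  apply: mu_le => // l /eigenvalue_nbr[y [y0 Y0 yA]].
  have r0 : 0 <= complex.Re `|l|.
    by have := normr_ge0 l; rewrite lecE => /andP[].
  have : complex.Re `|l| * complex.Re `|l| + (k%:R * k%:R + 1) <=
      (k%:R - 1) * complex.Re `|l| + k%:R * #|G|%:R.
    apply: (walk_rich_bound y0 Y0 yA) => //.
      by move=> u Wu; apply: none; exists u.
    by move: N2; rewrite /N; lra.
  rewrite -/c; move: (complex.Re _) r0 => r r0 rN.
  (* Completing the square: [(2 r - c)^2 <= c^2 + 4 (N - 1)]. *)
  rewrite /root ler_pdivlMr // -lerBlDl.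
  apply: le_trans (ler_norm _) _; rewrite -sqrtr_sqr ler_sqrt.
    by move: rN; rewrite /N; nra.
  by nra.
have := lt_le_trans lt_root (le_trans S_ge (le_trans mu_le_mu G_le)).
by rewrite ltxx.
Qed.

Theorem theorem4p2 (R : realType) (k : nat) (hk : (3 <= k)%N) :
  exists n0 : nat, forall n : nat, (n0 <= n)%N ->
    forall G : sgraph, #|G| = n ->
      mu R (S_graph n k) <= mu R G ->
      ~ graph_iso G (S_graph n k) ->
      has_subgraph G (T2 k) /\ has_subgraph G (T3 k).
Proof.
exists (20 * (k + 5) ^ 2)%N => n nG G eG; rewrite -{}eG in nG * => muG niso.
have [kn nq] := large_order nG.
have [||u Wu] := walk_rich_exists _ _ muG.
- by move: hk; clear; lia.
- by move: nq; clear; lia.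
have [//|[K fK]] := good_or_full hk nG Wu.
apply: contrapT => ngood; apply/niso/(iso_of_full_set fK) => a b aK bK.
apply/negP => ab; apply: ngood; apply: (good_of_full_set hk _ fK aK bK ab).
by move: nq; clear; lia.
Qed.
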